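(* Let $p$ be a prime, let $q=p^e$ with $q\equiv 1 \pmod 3$, and let $G$ be the transitive permutation group arising from $\mathrm{PSL}(2,q)$ acting on the left cosets of a subgroup of order $3$. Then $\rho(G)=4/3$ if $p\neq 5$, and $\rho(G)=2$ if $p=5$.
   Context: For a permutation group $G$ on a finite set $V$, a subset $\mathcal{F}\subseteq G$ is intersecting if for all $g,h\in\mathcal{F}$ there is $v\in V$ with $g(v)=h(v)$. The intersection density $\rho(G)$ is the maximum of $|\mathcal{F}|/\max\{|G_v|: v\in V\}$ over all intersecting sets $\mathcal{F}$ of $G$, where $G_v$ is the stabilizer of $v$. *)

(* Defs.v *)
From HB Require Import structures.
From mathcomp Require Import all_boot all_order all_algebra all_fingroup all_solvable.
Set Implicit Arguments. Unset Strict Implicit. Unset Printing Implicit Defensive.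
Import GRing.Theory.

(* A permutation group on a finite set V (a subset of a finite type T) is
   represented by a set of functions T -> T, each of which restricts to a
   permutation of V and is the identity outside V; so distinct elements of G
   are exactly distinct permutations of V. *)

Section Density.
Variable T : finType.

Definition intersecting (V : {set T}) (F : {set {ffun T -> T}}) : bool :=
  [forall f in F, forall g in F, exists v in V, f v == g v].

Definition stab (G : {set {ffun T -> T}}) (v : T) : {set {ffun T -> T}} :=
  [set f in G | f v == v].

Definition intersection_density (V : {set T}) (G : {set {ffun T -> T}}) : rat :=
  ((\max_(F : {set {ffun T -> T}} | (F \subset G) && intersecting V F) #|F|)%:R
   / (\max_(v in V) #|stab G v|)%:R)%R.
End Density.

Section PSL.
Variable F : finFieldType.

Definition SL2set : {set {'GL_2[F]}} := [set x | (\det (GLval x) == 1)%R].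

Lemma SL2_group_set : group_set SL2set.
Proof.
apply/group_setP; split; first by rewrite inE GL_1E det1.
move=> x y; rewrite !inE GL_ME => /eqP dx /eqP dy.
by rewrite det_mulmx dx dy mulr1.
Qed.

Canonical SL2_group := Group SL2_group_set.

Definition PSL2 : {set coset_of 'Z(SL2_group)} := (SL2_group / 'Z(SL2_group))%g.
End PSL.

Section CosetAction.
Variable gT : finGroupType.

Definition coset_space (H K : {set gT}) : {set {set gT}} := lcosets H K.

Definition left_mult_perm (H K : {set gT}) (g : gT) : {ffun {set gT} -> {set gT}} :=
  [ffun A => if A \in coset_space H K then (g *: A)%g else A].

Definition coset_perm_group (H K : {set gT}) : {set {ffun {set gT} -> {set gT}}} :=
  [set left_mult_perm H K g | g in K].
End CosetAction.

(* Main.v *)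
Require Import Defs.
From mathcomp Require Import all_boot all_order all_algebra all_fingroup all_solvable.
From mathcomp Require Import all_field ring.
Set Implicit Arguments. Unset Strict Implicit. Unset Printing Implicit Defensive.
Import GRing.Theory.
Local Open Scope ring_scope.

(** All elements of order 3 of PSL(2,q) are conjugate, so a set is intersecting iff
    any two distinct members differ by an element of order 3, that is, by a matrix of
    trace 1 or -1.  As tr (A^-1 B) is the polarisation of the quadratic form det on
    the 4-dimensional space of 2x2 matrices, such a set lifts to vectors whose Gram
    matrix has 2 on the diagonal and 1 or -1 elsewhere; all its 5x5 minors vanish in
    F.  Up to changing signs of vectors there are finitely many sign patterns: every
    5x5 determinant divides 810 = 2 * 3^4 * 5, which excludes five vectors unless p
    is 2 or 5, and no pattern on seven vectors has all its principal 5x5 minors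
    divisible by 5.  Over characteristic 2 a direct argument excludes five vectors.
    Explicit matrices attain the bounds 4 and 6. *)

(** * Integral determinants of sign patterns *)

(** Expansion along the first row, on integer functions of natural indices so that determinants
    evaluate by computation; [bump j] skips column [j]. *)
Fixpoint laplace n (f : nat -> nat -> int) : int :=
  if n is m.+1 then
    foldr (fun j acc =>
      (let d := f 0%N j * laplace m (fun a b => f a.+1 (bump j b)) in
       if odd j then - d else d) + acc) 0 (iota 0 n)
  else 1.

Lemma det_laplace n (f : nat -> nat -> int) :
  \det (\matrix_(i < n, j < n) f i j) = laplace n f.
Proof.
elim: n f => [|n IHn] f; first by rewrite det_mx00.
rewrite (expand_det_row _ ord0).
transitivity (\sum_(j < n.+1) (-1) ^+ j * (f 0%N j *
    laplace n (fun a b => f a.+1 (bump j b)))).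
  apply: eq_bigr => j _; rewrite mxE /cofactor add0n mulrCA -IHn.
  by congr (_ * (_ * \det _)); apply/matrixP=> a b; rewrite !mxE.
rewrite -(big_mkord xpredT (fun j => (-1) ^+ j * (f 0%N j *
    laplace n (fun a b => f a.+1 (bump j b))))).
rewrite /laplace -/laplace /index_iota subn0.
elim: (iota 0 n.+1) => [|j s IHs]; first by rewrite big_nil.
by rewrite big_cons IHs /= -signr_odd; case: odd; rewrite ?mulN1r ?mul1r.
Qed.

(* The symmetric matrix with diagonal 2 and off-diagonal entries 1 or -1,
   the entry at a < b being -1 iff bit a of row b is set. *)
Definition sign_gram (s : seq bitseq) (i j : nat) : int :=
  if i == j then 2%Z else
  if nth false (nth [::] s (maxn i j)) (minn i j) then (-1)%Z else 1%Z.

Fixpoint bitseqs n : seq bitseq :=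
  if n is m.+1 then [seq b :: s | b <- [:: true; false], s <- bitseqs m]
  else [:: [::]].

Lemma mem_bitseqs (s : bitseq) : s \in bitseqs (size s).
Proof. by elim: s => //= b s IHs; rewrite !mem_cat; case: b; rewrite map_f ?orbT. Qed.

(* The first bit is normalised: every vector but the first may be negated so that
   its product with the first one is 1. *)
Definition sign_rows n : seq bitseq :=
  if n is m.+1 then [seq false :: s | s <- bitseqs m] else [:: [::]].

(** [P] is tested on every prefix, so a failing pattern is never extended and the search stays
    small. *)
Fixpoint sign_patterns (P : pred (seq bitseq)) n : seq (seq bitseq) :=
  if n is m.+1 then
    filter P [seq rcons s r | s <- sign_patterns P m, r <- sign_rows m]
  else [:: [::]].

Definition minor5 (s : seq bitseq) (r : seq nat) : nat :=
  `|laplace 5 (fun i j => sign_gram s (nth 0%N r i) (nth 0%N r j))|%N.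

(** An exhaustive check of 64 patterns. As 0 does not divide 810, it also shows that none of these
    integral determinants vanishes. *)
Lemma minor5_dvd810 :
  all (fun s => minor5 s (iota 0 5) %| 810)%N (sign_patterns predT 5).
Proof. by vm_compute. Qed.

Fixpoint subseqs_of_size (T : Type) k (s : seq T) : seq (seq T) :=
  match k, s with
  | 0%N, _ => [:: [::]]
  | k'.+1, [::] => [::]
  | k'.+1, x :: s' =>
      [seq x :: r | r <- subseqs_of_size k' s'] ++ subseqs_of_size k s'
  end.

Lemma subseqs_of_sizeP (T : eqType) k (s r : seq T) :
  r \in subseqs_of_size k s -> size r = k /\ subseq r s.
Proof.
elim: s k r => [|x s IHs] [|k] r //=; rewrite ?inE; try by move=> /eqP->.
rewrite mem_cat => /orP[/mapP[t /IHs[<- ts] ->]|/IHs[-> rs]].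
  by rewrite /= eqxx.
by split=> //; apply: subseq_trans rs (subseq_cons s x).
Qed.

(* [find] rather than [all], which call-by-value reduction would not cut short. *)
Definition minors5_dvd5 (s : seq bitseq) : bool :=
  let l := subseqs_of_size 5 (iota 0 (size s)) in
  (size l <= find (fun r => ~~ (5 %| minor5 s r)) l)%N.

Lemma minors5_dvd5P s :
  (forall r, size r = 5 -> subseq r (iota 0 (size s)) -> 5 %| minor5 s r)%N ->
  minors5_dvd5 s.
Proof.
move=> dvd5; rewrite /minors5_dvd5 leqNgt -has_find has_predC negbK.
by apply/allP=> r /subseqs_of_sizeP[]; apply: dvd5.
Qed.

(** Patterns on fewer than five vectors have no minor to fail, so pruning starts at size 5. *)
Lemma sign_patterns7_nil : sign_patterns minors5_dvd5 7 = [::].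
Proof. by vm_compute. Qed.

(** * Gram matrices of unimodular matrices *)

Section Gram.
Variable F : fieldType.
Implicit Types A B : 'M[F]_2.

(* The polarisation of the determinant: A 0 0 * B 1 1 + ... = tr (adj A *m B). *)
Definition bform A B : F := A 0 0 * B 1 1 + A 1 1 * B 0 0 - A 0 1 * B 1 0 - A 1 0 * B 0 1.

Lemma bformC A B : bform A B = bform B A.
Proof. by rewrite /bform; ring. Qed.

Lemma det_mx22 A : \det A = A 0 0 * A 1 1 - A 0 1 * A 1 0.
Proof.
have l00 : lift 0 0 = 1 :> 'I_2 by apply: val_inj.
have l10 : lift 1 0 = 0 :> 'I_2 by apply: val_inj.
rewrite (expand_det_row _ 0) big_ord_recl big_ord1 /cofactor !det_mx11 !mxE.
by rewrite !l00 !l10 !expr0 expr1; ring.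
Qed.

Lemma bform_self A : bform A A = 2%:R * \det A.
Proof. by rewrite det_mx22 /bform; ring. Qed.

Lemma bformDl A1 A2 B : bform (A1 + A2) B = bform A1 B + bform A2 B.
Proof. by rewrite /bform !mxE; ring. Qed.

Lemma det_mx22D A B : \det (A + B) = \det A + \det B + bform A B.
Proof. by rewrite /bform !det_mx22 !mxE; ring. Qed.

(** The space of 2x2 matrices has dimension 4; the Gram matrix factors through it and has rank at
    most 4. *)
Lemma gram_det_eq0 (A : 'I_5 -> 'M[F]_2) : \det (\matrix_(i, j) bform (A i) (A j)) = 0.
Proof.
pose R := \matrix_(i < 5, k < 4)
  nth 0 [:: A i 0 0; A i 1 1; A i 0 1; A i 1 0] k.
pose K := \matrix_(k < 4, j < 5)
  nth 0 [:: A j 1 1; A j 0 0; - A j 1 0; - A j 0 1] k.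
have -> : \matrix_(i, j) bform (A i) (A j) = R *m K.
  apply/matrixP=> i j; rewrite !mxE !big_ord_recl big_ord0 !mxE /= /bform; ring.
apply/eqP/negPn/negP; rewrite -unitfE -unitmxE => /mxrank_unit rk.
by have := leq_trans (mxrankM_maxl R K) (rank_leq_col R); rewrite rk.
Qed.

Variables (p : nat) (pcharFp : p \in [pchar F]).

Lemma intr_pchar_eq0 (d : int) : (d%:~R == 0 :> F) = (p %| `|d|)%N.
Proof.
rewrite (dvdn_pcharf pcharFp); case: d => n //=.
by rewrite NegzE rmorphN oppr_eq0.
Qed.

Variables (A : nat -> 'M[F]_2) (n : nat).
Hypothesis detA : forall i, (i < n)%N -> \det (A i) = 1.
Hypothesis sgA : forall i j, (i < n)%N -> (j < n)%N -> i != j ->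
  bform (A i) (A j) = 1 \/ bform (A i) (A j) = -1.
Hypothesis A0 : forall i, (0 < i < n)%N -> bform (A 0) (A i) = 1.

(** A set bit stands for the value -1; in characteristic 2, where -1 = 1, no bit is set. *)
Definition gram_rows m : seq bitseq :=
  mkseq (fun b => mkseq (fun a => bform (A a) (A b) != 1) b) m.

Lemma bform_gram_rows m i j : (i < m <= n)%N -> (j < m)%N ->
  bform (A i) (A j) = (sign_gram (gram_rows m) i j)%:~R.
Proof.
wlog ij : i j / (i <= j)%N => [IH|].
  case/orP: (leq_total i j) => [|ji]; first exact: IH.
  move=> /andP[im mn] jm; rewrite bformC IH ?jm //.
  by rewrite /sign_gram eq_sym minnC maxnC.
move=> /andP[im mn] jm; have jn := leq_trans jm mn; have iN := leq_trans im mn.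
move: ij; rewrite leq_eqVlt => /predU1P[->|ij].
  by rewrite bform_self detA // /sign_gram eqxx mulr1.
rewrite /sign_gram (ltn_eqF ij) (minn_idPl (ltnW ij)) (maxn_idPr (ltnW ij)).
rewrite !nth_mkseq //.
have [->|->] := sgA iN jn (negbT (ltn_eqF ij)); first by rewrite eqxx.
by case: eqP => // ->.
Qed.

Lemma mem_gram_rows (P : pred (seq bitseq)) m : (m <= n)%N ->
  (forall k, (k <= m)%N -> P (gram_rows k)) -> gram_rows m \in sign_patterns P m.
Proof.
elim: m => [|m IHm] // mn PA; rewrite [sign_patterns _ _]/= mem_filter PA //=.
apply/allpairsP; exists (gram_rows m, mkseq (fun a => bform (A a) (A m) != 1) m).
split=> /=; first by apply: IHm => [|k km]; [apply: ltnW | apply/PA/ltnW].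
  case: m mn {IHm PA} => [|m] mn //=; rewrite /mkseq /= A0 // eqxx /=.
  apply: map_f; rewrite -[X in bitseqs X](size_iota 1 m).
  rewrite -(size_map (fun a => bform (A a) (A m.+1) != 1)); exact: mem_bitseqs.
by rewrite /gram_rows /mkseq -[in LHS]addn1 iotaD map_cat cats1.
Qed.

(** Modulo [p] the minor is the Gram determinant of five of the matrices, which vanishes in [F]. *)
Lemma minor5_gram_rows m r : (m <= n)%N -> size r = 5%N -> subseq r (iota 0 m) ->
  (p %| minor5 (gram_rows m) r)%N.
Proof.
move=> mn szr rs; rewrite /minor5 -intr_pchar_eq0 -det_laplace -det_map_mx.
have lt_r (i : 'I_5) : (nth 0 r i < m)%N.
  have := mem_subseq rs (mem_nth 0%N (_ : i < size r)%N).
  by rewrite szr mem_iota add0n /= => ->.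
apply/eqP; rewrite -[RHS](gram_det_eq0 (fun i => A (nth 0%N r i))).
congr (\det _); apply/matrixP=> i j; rewrite !mxE (bform_gram_rows (m := m)) ?lt_r //.
Qed.

Lemma gram_size_pchar5 : p = 5%N -> (n <= 6)%N.
Proof.
move=> p5; rewrite leqNgt; apply/negP=> n7.
have: gram_rows 7 \in sign_patterns minors5_dvd5 7.
  apply: mem_gram_rows => // k k7; apply: minors5_dvd5P => r szr.
  rewrite size_mkseq -[X in (X %| _)%N]p5; apply: minor5_gram_rows => //.
  exact: leq_trans n7.
by rewrite sign_patterns7_nil.
Qed.

Lemma gram_size_pchar_gt5 : p \notin [:: 2; 3; 5]%N -> (n <= 4)%N.
Proof.
move=> p235; rewrite leqNgt; apply/negP=> n5; case/negP: p235.
have /(allP minor5_dvd810) dv : gram_rows 5 \in sign_patterns predT 5.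
  exact: mem_gram_rows.
(* [primes 810] evaluates to the list of excluded primes. *)
have: p \in primes 810.
  rewrite mem_primes (pcharf_prime pcharFp) (dvdn_trans _ dv) //.
  exact: minor5_gram_rows.
by [].
Qed.

(* Over characteristic 2 all signs agree, so the sum of five vectors is orthogonal
   to the first four; these form a basis, but the sum has determinant 5 + 10. *)
Lemma gram_size_pchar2 : p = 2%N -> (n <= 4)%N.
Proof.
move=> p2; rewrite leqNgt; apply/negP=> n5.
have two0 : 2%:R = 0 :> F by apply/eqP; rewrite -(dvdn_pcharf pcharFp) p2.
have N1 : -1 = 1 :> F by apply/eqP; rewrite -subr_eq0 -opprD oppr_eq0 -mulr2n two0.
have A1 i j : (i < 5)%N -> (j < 5)%N -> i != j -> bform (A i) (A j) = 1.
  move=> i5 j5 ij; have := sgA (leq_trans i5 n5) (leq_trans j5 n5) ij.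
  by rewrite N1 => -[].
have A2 i : (i < 5)%N -> bform (A i) (A i) = 0.
  by move=> i5; rewrite bform_self two0 mul0r.
pose w := A 0 + A 1 + A 2 + A 3 + A 4.
have w_orth i : (i < 4)%N -> bform (A i) w = 0.
  have four0 : 1 + 1 + 1 + 1 = 0 :> F by rewrite -addrA -mulr2n two0 addr0.
  by case: i => [|[|[|[|i]]]] // _; rewrite bformC !bformDl A2 // !A1 //
    ?addr0 ?add0r four0.
have det_w : \det w = 1.
  rewrite !det_mx22D !bformDl !A1 // !detA ?(leq_trans _ n5) //.
  apply/eqP; rewrite -subr_eq0 (_ : _ - 1 = 2%:R * 7%:R); last by ring.
  by rewrite two0 mul0r.
pose R := \matrix_(i < 4, k < 4)
  nth 0 [:: A i 0 0; A i 1 1; A i 0 1; A i 1 0] k.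
pose K (B : 'M[F]_2) := \col_(k < 4) nth 0 [:: B 1 1; B 0 0; - B 1 0; - B 0 1] k.
have RK i B : (R *m K B) i 0 = bform (A i) B.
  by rewrite !mxE !big_ord_recl big_ord0 !mxE /= /bform; ring.
have uR : R \in unitmx.
  pose L := \matrix_(i < 4, j < 4) K (A j) i 0.
  suff: R *m L \in unitmx by rewrite unitmx_mul => /andP[].
  (* With no rows given all signs default to 1: the integral matrix with 2 on the diagonal and 1
     elsewhere has the odd determinant 5. *)
  have ->: R *m L = map_mx intr (\matrix_(i < 4, j < 4) sign_gram [::] i j).
    apply/matrixP=> i j; rewrite [RHS]mxE [in RHS]mxE.
    transitivity ((R *m K (A j)) i 0).
      by rewrite !mxE; apply: eq_bigr => k _; rewrite !mxE.
    rewrite RK /sign_gram nth_nil nth_nil; case: eqP => [->|/eqP ij].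
      by rewrite A2 ?two0 // ltnS ltnW.
    by rewrite A1 // ltnS ltnW.
  rewrite unitmxE unitfE det_map_mx det_laplace (_ : laplace _ _ = 5%Z) //.
  by rewrite intr_pchar_eq0 p2.
have Kw : K w = 0.
  rewrite -(mulKmx uR (K w)) (_ : R *m K w = 0) ?mulmx0 //.
  by apply/matrixP=> i j; rewrite ord1 RK w_orth // mxE.
have w0 (k : 'I_4) : K w k 0 = 0 by rewrite Kw mxE.
(* Coordinates 0 and 3 are [w 1 1] and [- w 0 1], so the second column of [w] vanishes, against
   determinant 1. *)
move: det_w (w0 (inord 0)) (w0 (inord 3)) => /eqP.
rewrite det_mx22 !mxE !inordK //= => dw w11 /eqP; rewrite oppr_eq0 => /eqP w01.
by move: dw; rewrite w11 w01 mulr0 mul0r subr0 eq_sym oner_eq0.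
Qed.

Lemma gram_size_bound : p != 3%N -> (n <= if p == 5 then 6 else 4)%N.
Proof.
move=> p3; case: eqP => [|/eqP p5]; first exact: gram_size_pchar5.
have [/gram_size_pchar2 //|/eqP p2] := p =P 2%N.
by apply: gram_size_pchar_gt5; rewrite !inE !negb_or p2 p3 p5.
Qed.

End Gram.

(** * Actions on the cosets of a subgroup of order 3 *)

Section CosetActionOrder3.
Local Open Scope group_scope.
Variables (gT : finGroupType) (H K : {group gT}).
Hypotheses (sHK : H \subset K) (oH : #|H| = 3%N).
Hypothesis conjH : forall k, k \in K -> #[k] = 3%N -> exists2 x, x \in K & k ^ x \in H.

(** A clique of the Cayley graph on [K] whose connection set consists of the elements of order 3. *)
Definition order3_clique (C : {set gT}) : bool :=
  (C \subset K) && [forall g in C, forall h in C, (g != h) ==> (#[g^-1 * h] == 3%N)].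

Lemma order3_cliqueP (C : {set gT}) :
  reflect (C \subset K /\ {in C &, forall g h, g != h -> #[g^-1 * h] = 3%N})
          (order3_clique C).
Proof.
apply: (iffP andP) => -[sCK clC]; split=> //.
  move=> g h Cg Ch gh.
  by move: clC => /forall_inP/(_ g Cg)/forall_inP/(_ h Ch)/implyP/(_ gh)/eqP.
apply/forall_inP=> g Cg; apply/forall_inP=> h Ch; apply/implyP=> gh.
by rewrite clC.
Qed.

Lemma order_mem_H k : k \in H -> k != 1 -> #[k] = 3%N.
Proof.
move=> Hk k1; have := order_dvdG Hk; rewrite oH.
by move/(prime_nt_dvdP (isT : prime 3)) => -> //; rewrite order_eq1.
Qed.

Lemma mem_coset_space x : x \in K -> x *: H \in coset_space H K.
Proof. by move=> Kx; apply/lcosetsP; exists x. Qed.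

Lemma left_mult_perm_lcoset g x : x \in K ->
  left_mult_perm H K g (x *: H) = (g * x) *: H.
Proof.
by move=> Kx; rewrite ffunE mem_coset_space // lcosetM.
Qed.

(** Agreement at a coset means that the quotient fixes it, and the stabiliser of [x *: H] is
    [H :^ x^-1]. *)
Lemma left_mult_perm_eqE g h x : x \in K ->
  (left_mult_perm H K g (x *: H) == left_mult_perm H K h (x *: H))
  = ((g^-1 * h) ^ x \in H).
Proof.
move=> Kx; rewrite !left_mult_perm_lcoset // eq_sym (sameP eqP lcoset_eqP) mem_lcoset.
by rewrite conjgE invMg !mulgA.
Qed.

Lemma exists_coset_eqP g h : g \in K -> h \in K ->
  reflect (g = h \/ #[g^-1 * h] = 3%N)
    [exists v in coset_space H K, left_mult_perm H K g v == left_mult_perm H K h v].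
Proof.
move=> Kg Kh; apply: (iffP exists_inP) => [[v]|].
  case/lcosetsP=> x Kx ->; rewrite left_mult_perm_eqE // => Hx.
  have [->|gh] := eqVneq g h; [by left | right].
  rewrite -(orderJ _ x) order_mem_H //.
  by rewrite -(conj1g x) (inj_eq (conjg_inj x)) -eq_mulVg1.
case=> [->|o3]; first by exists (1 *: H); rewrite ?mem_coset_space.
have [x Kx Hx] := conjH (groupM (groupVr Kg) Kh) o3.
by exists (x *: H); rewrite ?left_mult_perm_eqE ?mem_coset_space.
Qed.

Variable C : {set gT}.
Hypotheses (clC : order3_clique C) (C4 : (3 < #|C|)%N).

(* A nontrivial kernel would make H normal; then H contains every element of
   order 3, so a clique lies in a single coset of H. *)
Lemma left_mult_perm_inj : {in K &, injective (left_mult_perm H K)}.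
Proof.
have [sCK ordC] := order3_cliqueP _ clC.
move=> g h Kg Kh egh; apply/eqP; rewrite eq_mulVg1; apply/negPn/negP=> k1.
set k := g^-1 * h in k1.
(* The two permutations agree at every coset, so every conjugate of [k] lies in [H]. *)
have kH x : x \in K -> k ^ x \in H.
  by move=> Kx; rewrite -left_mult_perm_eqE // egh.
have genH x : x \in K -> <[k ^ x]> = H.
  move=> Kx; apply/eqP; rewrite eqEcard cycle_subG kH //= oH.
  by rewrite -orderE order_mem_H ?kH // -(conj1g x) (inj_eq (conjg_inj x)).
have nHK x : x \in K -> H :^ x = H.
  by move=> Kx; rewrite -[RHS](genH _ Kx) cycleJ -(genH 1 (group1 K)) conjg1.
have [c Cc] : exists c, c \in C by apply/card_gt0P; apply: leq_trans C4.
suff: C \subset c *: H.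
  by move/subset_leq_card; rewrite card_lcoset oH leqNgt C4.
apply/subsetP=> d Cd; rewrite mem_lcoset.
have [->|cd] := eqVneq c d; first by rewrite mulVg group1.
have Kcd : c^-1 * d \in K by rewrite groupM ?groupV ?(subsetP sCK).
have [x Kx Hx] := conjH Kcd (ordC _ _ Cc Cd cd).
by rewrite -(nHK x Kx) memJ_conjg in Hx.
Qed.

(** By injectivity, cliques and intersecting sets correspond with equal sizes, and each point
    stabiliser is the faithful image of a conjugate of [H]. *)
Lemma order3_intersection_density :
  (forall D, order3_clique D -> #|D| <= #|C|)%N ->
  intersection_density (coset_space H K) (coset_perm_group H K)
  = (#|C|%:R / 3%:R)%R.
Proof.
move=> maxC; have [sCK ordC] := order3_cliqueP _ clC.
have injK (D : {set gT}) : D \subset K -> {in D &, injective (left_mult_perm H K)}.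
  by move=> sDK g h Dg Dh; apply: left_mult_perm_inj; apply: (subsetP sDK).
rewrite /intersection_density; congr (_%:R / _%:R)%R; apply/eqP; rewrite eqn_leq.
  apply/andP; split.
    apply/bigmax_leqP=> S /andP[sSG intS].
    pose D := [set g in K | left_mult_perm H K g \in S].
    have sDK : D \subset K by apply/subsetP=> g /setIdP[].
    have defS : S = left_mult_perm H K @: D.
      apply/setP=> f; apply/idP/imsetP=> [Sf|[g /setIdP[_ Sg] -> //]].
      have /imsetP[g Kg def_f] := subsetP sSG _ Sf.
      by exists g; rewrite // inE Kg -def_f.
    rewrite defS card_in_imset; last exact: injK.
    apply: maxC; apply/order3_cliqueP; split=> // g h /setIdP[Kg Sg] /setIdP[Kh Sh] gh.
    move: intS => /forall_inP/(_ _ Sg)/forall_inP/(_ _ Sh)/(exists_coset_eqP Kg Kh).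
    by case=> // egh; rewrite egh eqxx in gh.
  rewrite -(card_in_imset (injK _ sCK)).
  apply: (bigmax_sup (left_mult_perm H K @: C)) => //; rewrite imsetS //=.
  apply/forall_inP=> _ /imsetP[g Cg ->]; apply/forall_inP=> _ /imsetP[h Ch ->].
  apply/exists_coset_eqP; rewrite ?(subsetP sCK) //.
  by have [|gh] := eqVneq g h; [left | right; apply: ordC].
have stabE x : x \in K ->
    stab (coset_perm_group H K) (x *: H) = left_mult_perm H K @: (H :^ x^-1).
  move=> Kx; apply/setP=> f; apply/setIdP/imsetP=> [[/imsetP[g Kg ->]]|[g Hg ->]].
    rewrite left_mult_perm_lcoset // (sameP eqP lcoset_eqP) mem_lcoset => Hg.
    by exists g => //; rewrite mem_conjgV conjgE.
  rewrite mem_conjgV in Hg.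
  have Kg : g \in K by rewrite -(groupJr _ Kx) (subsetP sHK).
  rewrite imset_f // left_mult_perm_lcoset // (sameP eqP lcoset_eqP) mem_lcoset.
  by rewrite -conjgE.
have stab3 x : x \in K -> #|stab (coset_perm_group H K) (x *: H)| = 3%N.
  move=> Kx; rewrite stabE // card_in_imset ?cardJg //.
  by apply: injK; rewrite conj_subG ?groupV.
apply/andP; split; first by apply/bigmax_leqP=> _ /lcosetsP[x Kx ->]; rewrite stab3.
by apply: (bigmax_sup (1 *: H)); rewrite ?stab3 ?mem_coset_space.
Qed.

End CosetActionOrder3.

(** * Elements of order 3 in PSL(2,q) *)

Section Matrix2.
Variable F : fieldType.
Implicit Types A B : 'M[F]_2.

Definition mx2 (a b c d : F) : 'M[F]_2 :=
  \matrix_(i, j) if i == 0 then if j == 0 then a else b else if j == 0 then c else d.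

Lemma ord2 (i : 'I_2) : i = 0 \/ i = 1.
Proof. by case: i => [[|[|//]] ?]; [left | right]; apply: val_inj. Qed.

Lemma matrix2P A B :
  A 0 0 = B 0 0 -> A 0 1 = B 0 1 -> A 1 0 = B 1 0 -> A 1 1 = B 1 1 -> A = B.
Proof.
move=> e00 e01 e10 e11; apply/matrixP=> i j.
by case: (ord2 i) => ->; case: (ord2 j) => ->.
Qed.

Lemma mulmx22E m (A : 'M[F]_(m, 2)) B i j :
  (A *m B) i j = A i 0 * B 0 j + A i 1 * B 1 j.
Proof.
rewrite mxE big_ord_recl big_ord1; congr (_ + A i _ * B _ j); exact: val_inj.
Qed.

Lemma mxtrace22 A : \tr A = A 0 0 + A 1 1.
Proof.
rewrite /mxtrace big_ord_recl big_ord1; congr (_ + A _ _); exact: val_inj.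
Qed.

Lemma bformN A B : bform A (- B) = - bform A B.
Proof. by rewrite /bform !mxE; ring. Qed.

Lemma bform_mulmx A B : bform A (A *m B) = \det A * \tr B.
Proof. by rewrite /bform det_mx22 mxtrace22 !mulmx22E; ring. Qed.

(** Cayley-Hamilton, applied twice. *)
Lemma mx22_cube A :
  A *m A *m A = (\tr A ^+ 2 - \det A) *: A - (\tr A * \det A)%:M.
Proof.
by apply: matrix2P; rewrite !(mulmx22E, mxE) det_mx22 mxtrace22 /=; ring.
Qed.

Lemma det_mx2 a b c d : \det (mx2 a b c d) = a * d - b * c.
Proof. by rewrite det_mx22 !mxE. Qed.

Lemma bform_mx2 a b c d a' b' c' d' :
  bform (mx2 a b c d) (mx2 a' b' c' d') = a * d' + d * a' - b * c' - c * b'.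
Proof. by rewrite /bform !mxE. Qed.

(* Rows of P are eigenvectors of A for the two primitive cube roots of unity. *)
Lemma trN1_diagonalizable (w : F) A : w ^+ 2 + w + 1 = 0 -> 3%:R != 0 :> F ->
  \det A = 1 -> \tr A = -1 ->
  exists2 P, \det P = 1 & P *m A = mx2 w 0 0 (w ^+ 2) *m P.
Proof.
move=> w1 nz3 dA tA.
(* As [A] has trace -1 and determinant 1, its characteristic polynomial is z^2 + z + 1. *)
have eigen z : z ^+ 2 + z + 1 = 0 -> exists2 u : 'rV_2, u != 0 & u *m A = z *: u.
  move=> z1; have /eqP/det0P[u nzu uA] : \det (A - z%:M) = 0.
    rewrite -[RHS]z1 (_ : \det _ = \det A - z * \tr A + z ^+ 2).
      by rewrite dA tA; ring.
    by rewrite !det_mx22 mxtrace22 !mxE /=; ring.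
  exists u => //; apply/eqP; rewrite -subr_eq0.
  by move: uA; rewrite mulmxBr mul_mx_scalar => ->.
have w2 : (w ^+ 2) ^+ 2 + w ^+ 2 + 1 = 0.
  rewrite (_ : _ + 1 = (w ^+ 2 + w + 1) * (w ^+ 2 - w + 1)); last by ring.
  by rewrite w1 mul0r.
have [u nzu uA] := eigen _ w1; have [v nzv vA] := eigen _ w2.
pose P := mx2 (u 0 0) (u 0 1) (v 0 0) (v 0 1).
have PA : P *m A = mx2 w 0 0 (w ^+ 2) *m P.
  have uAE j : (u *m A) 0 j = w * u 0 j by rewrite uA mxE.
  have vAE j : (v *m A) 0 j = w ^+ 2 * v 0 j by rewrite vA mxE.
  by apply: matrix2P; rewrite !mulmx22E !mxE /= ?mul0r ?addr0 ?add0r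
    -?uAE -?vAE mulmx22E.
(* Eigenvectors for distinct eigenvalues are independent: a relation [c] and its image under [A]
   force [c] to be 0. *)
have nzP : \det P != 0.
  apply/negP=> /det0P[c nzc cP].
  have Pj j : (P 0 j = u 0 j) * (P 1 j = v 0 j).
    by case: (ord2 j) => ->; rewrite !mxE.
  have cPE j : c 0 0 * u 0 j + c 0 1 * v 0 j = 0.
    by have := congr1 (fun X : 'rV_2 => X 0 j) cP; rewrite mulmx22E !Pj mxE.
  have cDPE j : c 0 0 * (w * u 0 j) + c 0 1 * (w ^+ 2 * v 0 j) = 0.
    have := congr1 (fun X : 'rV_2 => X 0 j) (congr1 (mulmx^~ A) cP).
    by rewrite /= -mulmxA PA mul0mx !mulmx22E !Pj !mxE /= => <-; ring.
  (* The discriminant of z^2 + z + 1 is (w - w^2)^2 = -3. *)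
  have nzw : w - w ^+ 2 != 0.
    apply: contraNneq nz3 => w0.
    rewrite -(oppr_eq0 3%:R) (_ : - 3%:R =
      (w - w ^+ 2) ^+ 2 - (w ^+ 2 - 3%:R * w + 3%:R) * (w ^+ 2 + w + 1)).
      by rewrite w0 w1 expr0n mulr0 subr0.
    by ring.
  have c1 : c 0 1 = 0.
    have /rV0Pn[j nzvj] := nzv; apply: (mulIf nzvj); apply: (mulIf nzw).
    rewrite !mul0r [LHS](_ : _ = w * (c 0 0 * u 0 j + c 0 1 * v 0 j)
      - (c 0 0 * (w * u 0 j) + c 0 1 * (w ^+ 2 * v 0 j))); last by ring.
    by rewrite cPE cDPE mulr0 subr0.
  have c0 : c 0 0 = 0.
    have /rV0Pn[j nzuj] := nzu; apply: (mulIf nzuj).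
    by rewrite mul0r -[RHS](cPE j) c1 mul0r addr0.
  by case/rV0Pn: nzc => j; case: (ord2 j) => ->; rewrite ?c0 ?c1 eqxx.
(* Scaling the first row makes the determinant 1 and keeps it an eigenvector. *)
exists (mx2 (\det P)^-1 0 0 1 *m P).
  by rewrite det_mulmx det_mx2 mulr1 mul0r subr0 mulVf.
rewrite -mulmxA PA !mulmxA; congr (_ *m _).
by apply: matrix2P; rewrite !mulmx22E !mxE /=; ring.
Qed.
End Matrix2.

Section PSL2Order3.
Variable F : finFieldType.
Let gT : finGroupType := {'GL_2[F]}.
Implicit Types x y : gT.
Local Notation SL := (SL2_group F).
Local Notation Z := 'Z(SL)%g.

Lemma mem_SL2 x : (x \in SL) = (\det (GLval x) == 1).
Proof. by rewrite inE. Qed.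

Lemma SL2_lift (A : 'M[F]_2) : \det A = 1 -> exists2 x, x \in SL & GLval x = A.
Proof.
move=> dA; have uA : A \in unitmx by rewrite unitmxE dA unitr1.
by exists (FinRing.Unit (uA : A \is a GRing.unit)); rewrite ?inE ?dA.
Qed.

Lemma GLvalM x y : GLval (x * y)%g = GLval x *m GLval y.
Proof. by []. Qed.

(** A matrix commuting with both elementary transvections is scalar. *)
Lemma center_SL2P x : x \in SL -> reflect (exists a, GLval x = a%:M) (x \in Z).
Proof.
move=> SLx; apply: (iffP idP) => [/centerP[_ cx]|[a xa]]; last first.
  apply/centerP; split=> // y _; apply: val_inj.
  change (GLval x *m GLval y = GLval y *m GLval x).
  by rewrite xa mul_scalar_mx mul_mx_scalar.
have [s SLs sE] : exists2 s, s \in SL & GLval s = mx2 1 1 0 1.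
  by apply: SL2_lift; rewrite det_mx2; ring.
have [t SLt tE] : exists2 t, t \in SL & GLval t = mx2 1 0 1 1.
  by apply: SL2_lift; rewrite det_mx2; ring.
have cs : GLval x *m GLval s = GLval s *m GLval x.
  by rewrite -2!GLvalM; congr GLval; exact: (cx _ SLs).
have ct : GLval x *m GLval t = GLval t *m GLval x.
  by rewrite -2!GLvalM; congr GLval; exact: (cx _ SLt).
have e i j (B C : 'M[F]_2) : B = C -> B i j = C i j by move->.
move: (e 0 0 _ _ ct) (e 0 0 _ _ cs) (e 0 1 _ _ cs).
rewrite sE tE !mulmx22E !mxE /= !(mulr0, mul0r, mulr1, mul1r, addr0, add0r).
move=> /(canRL (addKr _)); rewrite addNr => x01 /esym/(canRL (addKr _)).
rewrite addNr x01 addr0 add0r => x10 x11; exists (GLval x 0 0).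
by apply: matrix2P; rewrite [RHS]mxE ?x01 ?x10 ?x11.
Qed.

Lemma SL2_norm_center x : x \in SL -> x \in 'N(Z)%g.
Proof. exact: (subsetP (normal_norm (center_normal SL))). Qed.

Lemma coset_center_eq1 x : x \in SL -> (coset Z x == 1%g) = (x \in Z).
Proof.
move=> SLx; apply/eqP/idP => [|Zx]; last exact: coset_id.
exact/coset_idr/SL2_norm_center.
Qed.

Lemma coset_opp x y : x \in SL -> y \in SL -> GLval y = - GLval x ->
  coset Z y = coset Z x.
Proof.
move=> SLx SLy yx; apply/eqP; rewrite eq_mulVg1 -morphV ?SL2_norm_center //.
have SLyx := groupM (groupVr SLy) SLx.
rewrite -morphM ?groupV ?SL2_norm_center // coset_center_eq1 //.
apply/(center_SL2P SLyx).
have [z SLz zE] : exists2 z, z \in SL & GLval z = (-1)%:M.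
  by apply: SL2_lift; rewrite det_scalar sqrrN expr1n.
have -> : x = (y * z)%g.
  apply: val_inj; change (GLval x = GLval y *m GLval z).
  by rewrite zE mul_mx_scalar yx scaleN1r opprK.
by exists (-1); rewrite mulKg.
Qed.

Hypothesis nz3 : 3%:R != 0 :> F.

(** With t the trace, [mx22_cube] gives x^3 = (t^2 - 1) x - t, which for nonscalar x is scalar
    exactly when t^2 = 1. A scalar x has t^2 = 4, which is not 1 since 3 is nonzero. *)
Lemma order_coset_center x : x \in SL ->
  (#[coset Z x]%g == 3%N) = (\tr (GLval x) ^+ 2 == 1).
Proof.
move=> SLx; have dx : \det (GLval x) = 1 by apply/eqP; rewrite -mem_SL2.
have -> : (#[coset Z x]%g == 3%N) = (x \notin Z) && (x ^+ 3 \in Z)%g.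
  rewrite -(coset_center_eq1 SLx) -(coset_center_eq1 (groupX 3 SLx)).
  rewrite morphX ?SL2_norm_center //.
  apply/eqP/andP => [o3|[nt1 /eqP x3]]; last exact: nt_prime_order.
  split; first by rewrite -order_eq1 o3.
  by apply/eqP; rewrite -[RHS](expg_order (coset Z x)) o3.
have x3 : GLval (x ^+ 3)%g
    = (\tr (GLval x) ^+ 2 - 1) *: GLval x - (\tr (GLval x))%:M.
  by rewrite (_ : GLval _ = GLval x *m (GLval x *m GLval x)) // mulmxA mx22_cube dx mulr1.
apply/andP/eqP => [[nZx /(center_SL2P (groupX 3 SLx))[a]]|tx].
  rewrite x3 => /(canRL (subrK _)); rewrite -raddfD /= => tA.
  apply/eqP; rewrite -subr_eq0; apply: contraNT nZx => nzt.
  apply/(center_SL2P SLx); exists ((\tr (GLval x) ^+ 2 - 1)^-1 * (a + \tr (GLval x))).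
  by rewrite -scale_scalar_mx -tA scalerA mulVf // scale1r.
split; last first.
  apply/(center_SL2P (groupX 3 SLx)); exists (- \tr (GLval x)).
  by rewrite x3 tx subrr scale0r add0r raddfN.
apply/negP=> /(center_SL2P SLx)[a xa].
move: dx tx; rewrite xa det_scalar mxtrace_scalar => a1 tx.
case/eqP: nz3; transitivity (4%:R * a ^+ 2 - (a *+ 2) ^+ 2); last by ring.
by rewrite tx a1; ring.
Qed.

Lemma order_coset_bform x y : x \in SL -> y \in SL ->
  (#[(coset Z x)^-1 * coset Z y]%g == 3%N) = (bform (GLval x) (GLval y) ^+ 2 == 1).
Proof.
move=> SLx SLy; have SLxy := groupM (groupVr SLx) SLy.
rewrite -morphV ?SL2_norm_center // -morphM ?groupV ?SL2_norm_center //.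
rewrite order_coset_center // -[in RHS](mulKVg x y) GLvalM bform_mulmx.
by move: SLx; rewrite mem_SL2 => /eqP->; rewrite mul1r.
Qed.

Lemma mem_PSL2P c : c \in PSL2 F -> exists2 x, x \in SL & c = coset Z x.
Proof. by case/morphimP=> x _ SLx ->; exists x. Qed.

Lemma mem_PSL2 x : x \in SL -> coset Z x \in PSL2 F.
Proof. by move=> SLx; apply: mem_quotient. Qed.

Variable w : F.
Hypothesis w1 : w ^+ 2 + w + 1 = 0.

Lemma order3_PSL2_conj_diag x c : GLval x = mx2 w 0 0 (w ^+ 2) -> x \in SL ->
  c \in PSL2 F -> #[c]%g = 3%N -> exists2 z, z \in PSL2 F & c = (coset Z x ^ z)%g.
Proof.
move=> xD SLx /mem_PSL2P[y0 SLy0 ->] /eqP; rewrite order_coset_center // => ty0.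
(* Of [y0] and its opposite, one has trace -1. *)
have [y SLy [ty ->]] : exists2 y, y \in SL & \tr (GLval y) = -1 /\ coset Z y0 = coset Z y.
  move: ty0; rewrite sqrf_eq1 => /pred2P[ty0|ty0]; last by exists y0.
  have [y SLy yE] : exists2 y, y \in SL & GLval y = - GLval y0.
    apply: SL2_lift; rewrite -scaleN1r detZ sqrrN expr1n mul1r.
    by apply/eqP; rewrite -mem_SL2.
  by exists y; rewrite // yE raddfN /= ty0; split=> //; rewrite (coset_opp SLy0 SLy).
have dy : \det (GLval y) = 1 by apply/eqP; rewrite -mem_SL2.
have [P dP PA] := trN1_diagonalizable w1 nz3 dy ty.
have [z SLz zP] := SL2_lift dP; exists (coset Z z); first exact: mem_PSL2.
rewrite -morphJ ?SL2_norm_center //; congr (coset Z _).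
apply: (mulgI z); rewrite -conjgC; apply: val_inj.
by change (GLval (z * y)%g = GLval (x * z)%g); rewrite !GLvalM zP xD.
Qed.

Lemma order3_PSL2_conj c d : c \in PSL2 F -> #[c]%g = 3%N ->
  d \in PSL2 F -> #[d]%g = 3%N -> exists2 z, z \in PSL2 F & (c ^ z = d)%g.
Proof.
have [x SLx xE] : exists2 x, x \in SL & GLval x = mx2 w 0 0 (w ^+ 2).
  apply: SL2_lift; rewrite det_mx2.
  rewrite (_ : _ - _ = (w - 1) * (w ^+ 2 + w + 1) + 1); last by ring.
  by rewrite w1 mulr0 add0r.
move=> Gc oc Gd od.
have [y Gy ->] := order3_PSL2_conj_diag xE SLx Gc oc.
have [z Gz ->] := order3_PSL2_conj_diag xE SLx Gd od.
exists (y^-1 * z)%g; last by rewrite -conjgM mulKVg.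
exact: (groupM (G := (SL / Z)%G) (groupVr (G := (SL / Z)%G) Gy) Gz).
Qed.

(** * Cliques of PSL(2,q): upper bound and constructions *)

Local Notation clique := (order3_clique (SL / Z)%G).

Lemma order3_clique_of_matrices (s : seq 'M[F]_2) :
  all (fun A => \det A == 1) s -> pairwise (fun A B => bform A B ^+ 2 == 1) s ->
  exists2 C, clique C & #|C| = size s.
Proof.
move=> /allP dets pws; pose f A := odflt 1%g [pick x in SL | GLval x == A].
have fP A : A \in s -> f A \in SL /\ GLval (f A) = A.
  move=> /dets/eqP/SL2_lift[x SLx xA]; rewrite /f; case: pickP => [y /andP[SLy /eqP]//|].
  by move/(_ x); rewrite SLx xA eqxx.
pose l := [seq coset Z (f A) | A <- s].
pose r (c d : coset_of Z) := #[c^-1 * d]%g == 3%N.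
have r_sym : symmetric r by move=> c d; rewrite /r -orderV invMg invgK.
have r_irr : irreflexive r by move=> c; rewrite /r mulVg order1.
have pwl : pairwise r l.
  rewrite pairwise_map; apply: (sub_in_pairwise (P := mem s)) pws; last exact/allP.
  move=> A B /fP[SLA AE] /fP[SLB BE].
  by rewrite /= /r order_coset_bform // AE BE.
exists [set c | c \in l]; last first.
  (* No element is [r]-related to itself, so [pwl] makes the cosets distinct. *)
  by rewrite cardsE (card_uniqP _) ?size_map // (pairwise_uniq r_irr).
apply/order3_cliqueP; split.
  by apply/subsetP=> c; rewrite inE => /mapP[A /fP[SLA _] ->]; apply: mem_PSL2.
move=> c d; rewrite !inE => lc ld cd; apply/eqP; rewrite -/(r c d).
elim: l pwl lc ld => //= x l IHl /andP[/allP rx pwl]; rewrite !inE.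
case/predU1P=> [cx|lc] /predU1P[dx|ld].
- by rewrite cx dx eqxx in cd.
- by rewrite cx rx.
- by rewrite dx r_sym rx.
- exact: IHl.
Qed.

Variable p : nat.
Hypothesis pcharFp : p \in [pchar F].

Let max_clique := if p == 5%N then 6%N else 4%N.

Lemma order3_clique_le C : clique C -> (#|C| <= max_clique)%N.
Proof.
case/order3_cliqueP=> sCG ordC.
have [->|[c0 Cc0]] := set_0Vmem C; first by rewrite cards0.
have [x0 SLx0 c0E] := mem_PSL2P (subsetP sCG _ Cc0).
(* The sign of the lift is chosen so that its product with the fixed lift [x0] of [c0] is 1, the
   normalisation that [gram_size_bound] requires. *)
pose Q c x := (coset Z x == c) &&
  (if c == c0 then x == x0 else bform (GLval x0) (GLval x) == 1).
pose f c := odflt 1%g [pick x in SL | Q c x].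
have fP c : c \in C -> f c \in SL /\ Q c (f c).
  move=> Cc; rewrite /f; case: pickP => [x /andP[]//|no_x].
  have [y SLy cE] := mem_PSL2P (subsetP sCG _ Cc).
  have [cc0|cc0] := eqVneq c c0.
    by have /= := no_x x0; rewrite SLx0 /Q cc0 c0E !eqxx.
  have : #[c0^-1 * c]%g == 3%N by apply/eqP/ordC; rewrite // eq_sym.
  rewrite c0E cE order_coset_bform // sqrf_eq1 => /orP[b1|/eqP b1].
    by have /= := no_x y; rewrite SLy /Q cE eqxx -cE (negPf cc0) b1.
  have [z SLz zE] : exists2 z, z \in SL & GLval z = - GLval y.
    apply: SL2_lift; rewrite -scaleN1r detZ sqrrN expr1n mul1r.
    by apply/eqP; rewrite -mem_SL2.
  have /= := no_x z; rewrite SLz /Q cE (coset_opp SLy SLz zE) eqxx -cE (negPf cc0).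
  by rewrite zE bformN b1 opprK eqxx.
(* [c0] comes first because index 0 is the normalising one. *)
pose l := c0 :: enum (C :\ c0).
have szl : size l = #|C| by rewrite /= -cardE (cardsD1 c0 C) Cc0.
have uniql : uniq l by rewrite /= enum_uniq mem_enum !inE eqxx.
have lC i : (i < #|C|)%N -> nth c0 l i \in C.
  rewrite -szl => /(mem_nth c0); rewrite inE => /predU1P[->//|].
  by rewrite mem_enum => /setD1P[].
pose A i : 'M[F]_2 := GLval (f (nth c0 l i)).
apply: (gram_size_bound pcharFp (A := A)) => [i ltiC|i j ltiC ltjC ij|i /andP[i0 ltiC]|].
- by have [] := fP _ (lC i ltiC); rewrite mem_SL2 => /eqP.
- have [SLi /andP[/eqP fi _]] := fP _ (lC i ltiC).
  have [SLj /andP[/eqP fj _]] := fP _ (lC j ltjC).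
  apply/pred2P; rewrite -sqrf_eq1 -order_coset_bform // fi fj.
  by apply/eqP/ordC; rewrite ?lC // nth_uniq ?szl.
- have [_ /andP[_]] := fP _ (lC i ltiC); have [_ /andP[_]] := fP _ Cc0.
  have ni : nth c0 l i != c0.
    rewrite -[X in _ != X]/(nth c0 l 0) nth_uniq ?szl -?lt0n //.
    exact: leq_ltn_trans ltiC.
  by rewrite /A eqxx (negPf ni) => /eqP-> /eqP.
- by apply: contraNneq nz3 => <-; rewrite pcharf0.
Qed.

(* For p = 5 the six elements are (s + d) / 2 for d in {i, -i, j, -j, k, -k}, with
   i, j, k anticommuting of square -1 and s a scalar with s^2 = 3; in the proof 1/2 is written -2 and s^2 = -12. *)
Lemma order3_clique_exists : exists2 C, clique C & #|C| = max_clique.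
Proof.
have w2 : w ^+ 2 = - 1 - w by rewrite -[RHS]add0r -w1; ring.
rewrite /max_clique; case: eqP => [p5|_]; last first.
  (* After the identity come three matrices of trace w + w^2 = -1; all products are -1 except that
     of the last two, which is 2 - 1 = 1. *)
  apply: (order3_clique_of_matrices (s :=
    [:: mx2 1 0 0 1; mx2 w 0 0 (w ^+ 2); mx2 (w ^+ 2) 1 0 w; mx2 (w ^+ 2) 0 1 w])).
    by rewrite /= !det_mx2; do ?[apply/andP; split]; rewrite //; apply/eqP; ring: w2.
  by rewrite /= !bform_mx2; do ?[apply/andP; split]; rewrite //; apply/eqP; ring: w2.
have five0 : 5%:R = 0 :> F by apply/eqP; rewrite -(dvdn_pcharf pcharFp) p5.
pose s := 2%:R * (w - w ^+ 2).
have s2 : s ^+ 2 = - 12%:R by rewrite /s; ring: w2.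
pose A (a b c d : F) :=
  mx2 (- 2%:R * (s + a)) (- 2%:R * b) (- 2%:R * c) (- 2%:R * (s + d)).
have detA a b c d : \det (A a b c d) = 4%:R * ((s + a) * (s + d) - b * c).
  by rewrite det_mx2; ring.
have bformA a b c d a' b' c' d' : bform (A a b c d) (A a' b' c' d') =
    4%:R * ((s + a) * (s + d') + (s + d) * (s + a') - b * c' - c * b').
  by rewrite bform_mx2; ring.
(* [ring] does not reduce modulo 5, so each value is given with an explicit multiple of 5. The
   determinants are -64 and -44; the products are -64 or -104 for opposite d and -96 otherwise. *)
have eq1 (x k : F) : x = 1 - 5%:R * k -> x == 1 by move=> ->; rewrite five0 mul0r subr0.
have sqr_eq1 (x k : F) : x = 1 - 5%:R * k \/ x = -1 - 5%:R * k -> x ^+ 2 == 1.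
  by rewrite five0 mul0r !subr0 sqrf_eq1 => /pred2P.
apply: (order3_clique_of_matrices (s :=
  [:: A 2%:R 0 0 (- 2%:R); A (- 2%:R) 0 0 2%:R; A 0 1 (-1) 0; A 0 (-1) 1 0;
      A 0 2%:R 2%:R 0; A 0 (- 2%:R) (- 2%:R) 0])).
  rewrite /= !detA; do ?[apply/andP; split]; rewrite //;
    by [apply: (eq1 _ 13%:R); ring: s2 | apply: (eq1 _ 9%:R); ring: s2].
rewrite /= !bformA; do ?[apply/andP; split]; rewrite //;
  by [apply: (sqr_eq1 _ 13%:R); left; ring: s2
     |apply: (sqr_eq1 _ 21%:R); left; ring: s2
     |apply: (sqr_eq1 _ 19%:R); right; ring: s2].
Qed.

End PSL2Order3.

(** The unit group has order q - 1, divisible by 3; an element u of order 3 satisfies u^3 - 1 = 0,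
    and the factor u - 1 is nonzero. *)
Lemma cube_root_of_unity (F : finFieldType) :
  (#|F| %% 3 = 1)%N -> exists w : F, w ^+ 2 + w + 1 = 0.
Proof.
move=> F1; have dv3 : (3 %| #|[set: {unit F}]|)%N.
  rewrite card_finField_unit; have := divn_eq #|F| 3; rewrite F1 addn1 => ->.
  exact: dvdn_mull.
have [u _ ou] := Cauchy (isT : prime 3) dv3.
exists (val u); have u3 : val u ^+ 3 = 1 by rewrite -FinRing.val_unitX -ou expg_order.
have u1 : val u - 1 != 0.
  rewrite subr_eq0; apply: contra_eqN ou => /eqP u1.
  by rewrite (_ : u = 1%g) ?order1 //; apply: val_inj.
apply: (mulfI u1); rewrite mulr0 (_ : _ * _ = val u ^+ 3 - 1); last by ring.
by rewrite u3 subrr.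
Qed.

Theorem theorem6p1 (F : finFieldType) (p e : nat) :
  prime p -> #|F| = (p ^ e)%N -> (p ^ e %% 3 = 1)%N ->
  forall H : {group coset_of 'Z(SL2_group F)},
    H \subset PSL2 F -> #|H| = 3%N ->
    intersection_density (coset_space H (PSL2 F)) (coset_perm_group H (PSL2 F))
    = (if p == 5%N then 2%:R else 4%:R / 3%:R)%R.
Proof.
move=> pr_p oF q1 H sHG oH.
have pcharFp := card_finPcharP oF pr_p.
have nz3 : 3%:R != 0 :> F.
  rewrite -(dvdn_pcharf pcharFp) (dvdn_prime2 pr_p) //.
  (* If p = 3, then q is 1 or a multiple of 3; the first is impossible for a field, the second
     contradicts q = 1 modulo 3. *)
  apply/eqP=> p3; move: q1; case: e oF => [|e] oF.
    by have := finNzRing_gt1 F; rewrite oF.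
  by rewrite p3 expnS modnMr.
have [w w1] : exists w : F, w ^+ 2 + w + 1 = 0.
  by apply: cube_root_of_unity; rewrite oF.
have conjH k : k \in PSL2 F -> #[k]%g = 3%N -> exists2 x, x \in PSL2 F & (k ^ x)%g \in H.
  move=> Gk ok; have dv3 : (3 %| #|H|)%N by rewrite oH.
  have [h Hh oh] := Cauchy (isT : prime 3) dv3.
  have [x Gx kx] := order3_PSL2_conj nz3 w1 Gk ok (subsetP sHG h Hh) oh.
  by exists x; rewrite ?kx.
have [C clC oC] := order3_clique_exists nz3 w1 pcharFp.
rewrite (order3_intersection_density (K := (SL2_group F / 'Z(SL2_group F))%G)
  sHG oH conjH clC); rewrite ?oC.
- by case: ifP.
- by case: ifP.
- by move=> D /(order3_clique_le nz3 pcharFp).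
Qed.
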